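(* Let $\mathcal{W}=(P,T,F,i,o)$ be a sound, acyclic, free choice (colored) workflow net. Then $\mathcal{W}$ can be transformed into a net whose only places are $i$ and $o$ and which has a single transition from $i$ to $o$. This transformation uses at most $|T|$ applications of the merge rule and at most $\mathit{Shoc}(\mathcal{W})$ applications of the d-shortcut rule.
   Context: A workflow net $(P,T,F,i,o)$ has the following components: - finite disjoint sets $P$ of places and $T$ of transitions; - arcs $F\subseteq(P\times T)\cup(T\times P)$; - a place $i$ without incoming arcs and a place $o$ without outgoing arcs; - the requirement that $(P\cup T,F\cup\{(o,i)\})$ is strongly connected. ${}^\bullet x$ and $x^\bullet$ denote input and output nodes. Markings and firing are standard. The initial (final) marking has exactly one token, on $i$ (on $o$). The net is sound if the final marking is reachable from every marking reachable from the initial marking, and every transition occurs in some firing sequence from the initial marking. It is free choice if for all places $p_1,p_2$, either $p_1^\bullet\cap p_2^\bullet=\emptyset$ or $p_1^\bullet=p_2^\bullet$. It is acyclic if $(P\cup T,F)$ is acyclic. A colored version additionally carries color sets and transformer relations $\lambda(t)$; these do not affect rule applicability. The cluster $[x]$ of a node $x$ is the smallest set containing $x$, closed under $p\mapsto p^\bullet$ for places and $t\mapsto{}^\bullet t$ for transitions. A cluster $c$ is free choice if $(p,t)\in F$ for all places $p\in c$ and transitions $t\in c$. Merge rule: two distinct transitions $t_1,t_2$ with ${}^\bullet t_1={}^\bullet t_2$ and $t_1^\bullet=t_2^\bullet$ are replaced by one fresh transition with those input and output sets and transformer $\lambda(t_1)\cup\lambda(t_2)$. d-shortcut rule: suppose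 $t$ is a transition and $c\notin\{[o],[t]\}$ is a free choice cluster with exactly one transition $t'$ such that all places of $c$ lie in $t^\bullet$. Then: 1. remove $t$; 2. add a fresh transition $t'_s$ with ${}^\bullet t'_s={}^\bullet t$, $t'^\bullet_s=(t^\bullet\setminus{}^\bullet t')\cup t'^\bullet$, and transformer the sequential composition of $\lambda(t)$ followed by $\lambda(t')$; 3. remove $c$ if no place of $c$ still has an input transition. For a transition $t$, $\mathit{shoc}(t)$ is the length of a longest maximal firing sequence (from the initial marking, not extendable) that contains $t$, minus $1$; these sequences are finite by acyclicity. $\mathit{Shoc}(\mathcal{W})=\sum_{t\in T}\mathit{shoc}(t)$. *)

(* Defs.v *)
From Stdlib Require Import Relations.
From mathcomp Require Import all_boot.

Set Implicit Arguments.
Unset Strict Implicit.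
Unset Printing Implicit Defensive.

(* Nodes of a net: places and transitions are identified by naturals in two
   separate name spaces (so P and T are disjoint by construction). *)
Inductive node := PN of nat | TN of nat.

Section Nets.
Variable L : Type.  (* type of transformer labels lambda(t) (colored version) *)

(* A (colored) net.  [pt p t] : arc (p,t) in F ; [tp t p] : arc (t,p) in F. *)
Record wnet := WNet {
  places : seq nat;
  trans  : seq nat;
  src    : nat;
  snk    : nat;
  pt     : nat -> nat -> bool;
  tp     : nat -> nat -> bool;
  lam    : nat -> L
}.

Implicit Types (N : wnet) (M : nat -> nat) (s : seq nat).

Definition well_formed N : Prop :=
  [/\ uniq (places N), uniq (trans N),
      (forall p t, pt N p t -> (p \in places N) && (t \in trans N)) &
      (forall t p, tp N t p -> (t \in trans N) && (p \in places N))].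

Definition in_net N (x : node) : bool :=
  match x with PN p => p \in places N | TN t => t \in trans N end.

Definition edge N (x y : node) : Prop :=
  match x, y with
  | PN p, TN t => pt N p t
  | TN t, PN p => tp N t p
  | _, _ => False
  end.

Definition edge_oi N (x y : node) : Prop :=
  edge N x y \/ (x = PN (snk N) /\ y = PN (src N)).

Definition workflow N : Prop :=
  [/\ src N \in places N, snk N \in places N & src N != snk N] /\
  [/\ (forall t, ~~ tp N t (src N)),
      (forall t, ~~ pt N (snk N) t) &
      (forall x y, in_net N x -> in_net N y ->
                   clos_refl_trans node (edge_oi N) x y)].

Definition acyclic N : Prop := forall x, ~ clos_trans node (edge N) x x.

Definition free_choice N : Prop :=
  forall p1 p2, p1 \in places N -> p2 \in places N ->
    (forall t, ~~ (pt N p1 t && pt N p2 t)) \/ (forall t, pt N p1 t = pt N p2 t).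

Definition M0 N : nat -> nat := fun p => (p == src N : nat).
Definition Mf N : nat -> nat := fun p => (p == snk N : nat).

Definition enabled N t M : Prop :=
  t \in trans N /\ forall p, pt N p t -> 0 < M p.

Definition fire N t M : nat -> nat :=
  fun p => M p - pt N p t + tp N t p.

Fixpoint firable N M s : Prop :=
  match s with
  | [::] => True
  | t :: s' => enabled N t M /\ firable N (fire N t M) s'
  end.

Fixpoint after N M s : nat -> nat :=
  match s with
  | [::] => M
  | t :: s' => after N (fire N t M) s'
  end.

Definition sound N : Prop :=
  (forall s, firable N (M0 N) s ->
     exists s', firable N (after N (M0 N) s) s' /\
                after N (after N (M0 N) s) s' =1 Mf N) /\
  (forall t, t \in trans N -> exists s, firable N (M0 N) s /\ t \in s).

Definition maximal_run N s : Prop :=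
  firable N (M0 N) s /\ forall t, ~ enabled N t (after N (M0 N) s).

Definition is_shoc N t (k : nat) : Prop :=
  (exists s, [/\ maximal_run N s, t \in s & size s = k.+1]) /\
  (forall s, maximal_run N s -> t \in s -> size s <= k.+1).

Definition cstep N (x y : node) : Prop :=
  match x, y with
  | PN p, TN t => pt N p t
  | TN t, PN p => pt N p t
  | _, _ => False
  end.

Definition in_cluster N (x y : node) : Prop := clos_refl_trans node (cstep N) x y.

Definition cl_eq N (x y : node) : Prop :=
  forall z, in_cluster N x z <-> in_cluster N y z.

Definition fc_cluster N (x : node) : Prop :=
  forall p t, in_cluster N x (PN p) -> in_cluster N x (TN t) -> pt N p t.

(* Merge rule (cup = union of transformer relations). *)
Definition merge_step (cup : L -> L -> L) N N' : Prop :=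
  exists t1 t2 t,
  [/\ t1 \in trans N, t2 \in trans N & t1 != t2] /\
  [/\ (forall p, pt N p t1 = pt N p t2),
      (forall p, tp N t1 p = tp N t2 p) &
      t \notin trans N] /\
  [/\ src N' = src N, snk N' = snk N,
      places N' = places N &
      uniq (trans N')] /\
  [/\
      (forall u, u \in trans N' <-> u = t \/ (u \in trans N /\ u <> t1 /\ u <> t2)),
      (forall p u, pt N' p u <->
          (u = t /\ pt N p t1) \/ (u <> t1 /\ u <> t2 /\ u <> t /\ pt N p u)),
      (forall u p, tp N' u p <->
          (u = t /\ tp N t1 p) \/ (u <> t1 /\ u <> t2 /\ u <> t /\ tp N u p)),
      lam N' t = cup (lam N t1) (lam N t2) &
      (forall u, u \in trans N' -> u <> t -> lam N' u = lam N u)].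

(* d-shortcut rule (comp = sequential composition of transformers).
   The cluster c is [x]; t' is its unique transition; ts is the fresh t'_s. *)
Definition shortcut_step (comp : L -> L -> L) N N' : Prop :=
  exists t x t' ts,
  [/\ t \in trans N, in_net N x,
      ~ cl_eq N x (PN (snk N)) & ~ cl_eq N x (TN t)] /\
  [/\ fc_cluster N x,
      (forall u, in_cluster N x (TN u) <-> u = t'),
      (forall p, in_cluster N x (PN p) -> tp N t p) &
      ts \notin trans N] /\
  (* net after steps 1 and 2 *)
  let ptI p u := (u <> t /\ u <> ts /\ pt N p u) \/ (u = ts /\ pt N p t) in
  let tpI u p := (u <> t /\ u <> ts /\ tp N u p) \/
                 (u = ts /\ ((tp N t p /\ ~~ pt N p t') \/ tp N t' p)) in
  (* step 3 applies iff no place of c still has an input transition *)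
  let rem := forall p u, in_cluster N x (PN p) -> ~ tpI u p in
  let inc p := rem /\ in_cluster N x (PN p) in
  [/\ src N' = src N, snk N' = snk N,
      uniq (places N') & uniq (trans N')] /\
  [/\
      (forall p, p \in places N' <-> p \in places N /\ ~ inc p),
      (forall u, u \in trans N' <->
           (u = ts \/ (u \in trans N /\ u <> t)) /\ ~ (rem /\ u = t')),
      (forall p u, pt N' p u <-> ptI p u /\ ~ inc p /\ ~ (rem /\ u = t')) &
      (forall u p, tp N' u p <-> tpI u p /\ ~ inc p /\ ~ (rem /\ u = t'))] /\
  [/\ lam N' ts = comp (lam N t) (lam N t') &
      (forall u, u \in trans N' -> u <> ts -> lam N' u = lam N u)].

Inductive reduces (cup comp : L -> L -> L) : wnet -> wnet -> nat -> nat -> Prop :=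
| red_refl N : reduces cup comp N N 0 0
| red_merge N N1 N2 m d :
    merge_step cup N N1 -> reduces cup comp N1 N2 m d -> reduces cup comp N N2 m.+1 d
| red_short N N1 N2 m d :
    shortcut_step comp N N1 -> reduces cup comp N1 N2 m d -> reduces cup comp N N2 m d.+1.

Definition final_net N (i o : nat) : Prop :=
  (forall p, p \in places N <-> p = i \/ p = o) /\
  exists t, [/\ (forall u, u \in trans N <-> u = t),
                (forall p, pt N p t <-> p = i) &
                (forall p, tp N t p <-> p = o)].

End Nets.

(* Main.v *)
Require Import Defs.
From Stdlib Require Import Relations Classical ClassicalEpsilon FunctionalExtensionality.
From mathcomp Require Import all_boot zify.

Set Implicit Arguments.
Unset Strict Implicit.
Unset Printing Implicit Defensive.

(* Unless the net is a single transition from i to o, one of the rules applies. If no cluster has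
   a choice, the initial transition t puts tokens on exactly its outputs, so any transition
   enabled next can be d-shortcut with t. Otherwise fire a choice, between t_a and t_b, after
   which only forced transitions occur; if no d-shortcut applies, then both alternatives are
   completed by the same multiset of transitions, so t_a and t_b have the same outputs and can be
   merged. Both rules preserve soundness: a run of the new net expands to a run of the old one
   with the same markings, and the new net deadlocks only in the final marking. For the
   d-shortcut this uses that the net is safe.

   A merge lowers |T| and does not raise Shoc; a d-shortcut does not raise |T|, and it lowers
   Shoc since every occurrence of t'_s expands to two firings. *)

(** * Runs and soundness *)

Section Runs.
Variable L : Type.
Implicit Types (N : wnet L) (M : nat -> nat) (s : seq nat).

Lemma firable_cat N M s1 s2 :
  firable N M (s1 ++ s2) <-> firable N M s1 /\ firable N (after N M s1) s2.
Proof. elim: s1 M => [|t s1 IH] M /=; first by tauto. rewrite IH; tauto. Qed.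

Lemma after_cat N M s1 s2 : after N M (s1 ++ s2) = after N (after N M s1) s2.
Proof. by elim: s1 M => [|t s1 IH] M //=. Qed.

Lemma firable_trans N M s : firable N M s -> {subset s <= trans N}.
Proof.
elim: s M => [|t s IH] M //= [[tN _] /IH sN] u.
by rewrite in_cons => /orP[/eqP->|/sN].
Qed.

Lemma firable_split N M s t : firable N M s -> t \in s ->
  exists s1 s2, [/\ s = s1 ++ t :: s2, firable N M s1 & enabled N t (after N M s1)].
Proof.
move=> fs ts; case/splitPr: ts fs => s1 s2 /firable_cat[f1 /= [en _]].
by exists s1, s2.
Qed.

Lemma marking_equation N M s p : firable N M s ->
  after N M s p + count (pt N p) s = M p + count (fun t => tp N t p) s.
Proof.
elim: s M => [|t s IH] M //= [[tN en] /IH]; rewrite /fire.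
have := en p; case: (pt N p t) => [/(_ isT)|_] /=; lia.
Qed.

(** For runs whose multiplicities are known to agree only on some transitions, such as those feeding
    a given place. *)
Lemma count_sub_mem (a : pred nat) s1 s2 :
  (forall u, a u -> count_mem u s1 = count_mem u s2) -> count a s1 = count a s2.
Proof.
move=> eqc; rewrite -!size_filter; apply: perm_size; apply/allP => u /= _.
rewrite !count_filter.
have E s : count (predI (pred1 u) a) s = a u * count_mem u s.
  case au: (a u); rewrite ?mul1n ?mul0n.
    by apply: eq_count => v /=; case: eqP => //= ->.
  by rewrite -(count_pred0 s); apply: eq_count => v /=; case: eqP => //= ->.
by rewrite !E; case au: (a u) => //; rewrite eqc.
Qed.

Definition reach N M := exists2 s, firable N (M0 N) s & M = after N (M0 N) s.

Lemma reach0 N : reach N (M0 N). Proof. by exists [::]. Qed.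

Lemma reach_after N M s : reach N M -> firable N M s -> reach N (after N M s).
Proof.
move=> [s0 f0 ->] fs; exists (s0 ++ s); last by rewrite after_cat.
by apply/firable_cat.
Qed.

Lemma reach_fire N M t : reach N M -> enabled N t M -> reach N (fire N t M).
Proof. by move=> rM en; apply: (@reach_after N M [:: t] rM). Qed.

Definition complete N s := firable N (M0 N) s /\ after N (M0 N) s = Mf N.

(** The predicate restricts the firings: [follows] gives runs under a fixed choice policy, [predT]
    ordinary maximal runs. *)
Lemma firable_maximal N (P : pred nat) B M :
  (forall s, firable N M s -> size s <= B) ->
  exists s, [/\ firable N M s, all P s &
                forall t, P t -> ~ enabled N t (after N M s)].
Proof.
elim: B M => [|B IH] M bM.
  exists [::]; split=> // t _ en; by have := bM [:: t] (conj en I).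
case: (classic (exists2 t, P t & enabled N t M)) => [[t Pt en]|no]; last first.
  by exists [::]; split=> // t Pt en; apply: no; exists t.
have [|s [fs As ms]] := IH (fire N t M).
  by move=> s fs; have := bM (t :: s) (conj en fs).
by exists (t :: s); split=> //=; rewrite Pt.
Qed.

Lemma last_marking N (Q : (nat -> nat) -> Prop) B M :
  (forall s, firable N M s -> size s <= B) -> reach N M -> Q M ->
  exists M', [/\ reach N M', Q M' &
    forall t s, firable N M' (t :: s) -> ~ Q (after N M' (t :: s))].
Proof.
elim: B M => [|B IH] M bM rM QM.
  by exists M; split=> // t s /bM.
case: (classic (exists t s, firable N M (t :: s) /\ Q (after N M (t :: s)))).
  move=> [t [s [fs Qs]]]; apply: (IH _ _ _ Qs); last exact: reach_after.
  move=> s' fs'; have := bM ((t :: s) ++ s'); rewrite size_cat /= => bd.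
  have : firable N M ((t :: s) ++ s') by apply/firable_cat.
  by move/bd; lia.
by move=> no; exists M; split=> // t s fs Qs; apply: no; exists t, s.
Qed.

(* The invariant of the reduction: [rk] witnesses acyclicity, strong connectivity is weakened to
   local conditions on arcs, and the firability of every transition is dropped because it
   follows from the rest ([trans_fires]). *)
Record good (rk : nat -> nat) (H : nat) N : Prop := Good {
  g_wf : well_formed N;
  g_srcP : src N \in places N;
  g_snkP : snk N \in places N;
  g_neq : src N != snk N;
  g_src : forall t, ~~ tp N t (src N);
  g_snk : forall t, ~~ pt N (snk N) t;
  g_in : forall p, p \in places N -> p <> src N -> exists t, tp N t p;
  g_pre : forall t, t \in trans N -> exists p, pt N p t;
  g_post : forall t, t \in trans N -> exists p, tp N t p;
  g_fc : forall p q t u, pt N p t -> pt N q t -> pt N p u -> pt N q u;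
  g_rk : forall p t q, pt N p t -> tp N t q -> rk p < rk q;
  g_H : forall p, p \in places N -> rk p <= H;
  g_sound : forall M, reach N M -> exists2 s, firable N M s & after N M s = Mf N
}.

Section Good.
Variables (rk : nat -> nat) (H : nat) (N : wnet L).

(* Places are weighted so that an input place outweighs all places of higher rank together. *)
Lemma weight_bound M :
  well_formed N ->
  (forall t, t \in trans N -> exists p, pt N p t) ->
  (forall p t q, pt N p t -> tp N t q -> rk p < rk q) ->
  (forall p, p \in places N -> rk p <= H) ->
  exists B, forall s, firable N M s -> size s <= B.
Proof.
move=> [uP uT ptN tpN] pre rkN rkH.
pose K := (size (places N)).+1.
pose w p := K ^ (H - rk p).
pose Phi M := \sum_(p <- places N) M p * w p.
exists (Phi M) => s; elim: s M => [|t s IH] M //= [[tN en] /IH fs].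
apply: leq_ltn_trans fs _.
have [p0 p0t] := pre t tN; have /andP[p0P _] := ptN _ _ p0t.
have E : Phi (fire N t M) + \sum_(p <- places N) pt N p t * w p =
         Phi M + \sum_(p <- places N) tp N t p * w p.
  rewrite /Phi -!big_split /=; apply: eq_bigr => p _.
  rewrite /fire -!mulnDl; congr (_ * _).
  by have := en p; case: (pt N p t) => [/(_ isT)|_] /=; lia.
suff : \sum_(p <- places N) tp N t p * w p < \sum_(p <- places N) pt N p t * w p.
  by move: E; lia.
have A : w p0 <= \sum_(p <- places N) pt N p t * w p.
  by rewrite (bigD1_seq p0) //= p0t mul1n leq_addr.
(* Each step up in rank divides the weight by [K], and fewer than [K] places can receive tokens. *)
have C : (\sum_(p <- places N) tp N t p * w p) * K <= size (places N) * w p0.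
  rewrite big_distrl /= -sum1_size big_distrl /= !big_seq.
  apply: leq_sum => p pP; rewrite mul1n.
  case tpp: (tp N t p) => //=; rewrite mul1n /w -expnSr leq_exp2l //.
    by have := rkN _ _ _ p0t tpp; have := rkH _ pP; lia.
  by rewrite /K ltnS; case: (places N) p0P.
have w0 : 0 < w p0 by rewrite expn_gt0.
have : (\sum_(p <- places N) tp N t p * w p) * K < w p0 * K.
  by apply: leq_ltn_trans C _; rewrite mulnC ltn_pmul2l // /K.
by rewrite ltn_pmul2r //; lia.
Qed.

Hypothesis gN : good rk H N.

Lemma runs_bounded M : exists B, forall s, firable N M s -> size s <= B.
Proof. by case: gN => *; apply: weight_bound. Qed.

Lemma pt_place p t : pt N p t -> p \in places N.
Proof. by case: (g_wf gN) => _ _ h _ /h/andP[]. Qed.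
Lemma pt_trans p t : pt N p t -> t \in trans N.
Proof. by case: (g_wf gN) => _ _ h _ /h/andP[]. Qed.
Lemma tp_place t p : tp N t p -> p \in places N.
Proof. by case: (g_wf gN) => _ _ _ h /h/andP[]. Qed.
Lemma tp_trans t p : tp N t p -> t \in trans N.
Proof. by case: (g_wf gN) => _ _ _ h /h/andP[]. Qed.

Lemma pt_Mf p t : pt N p t -> Mf N p = 0.
Proof.
by rewrite /Mf; case: eqP => // -> h; have := g_snk gN t; rewrite h.
Qed.

Lemma pt_tp p t : pt N p t -> tp N t p = false.
Proof. by move=> a; apply/negP => /(g_rk gN a); rewrite ltnn. Qed.

Lemma fc_eq p q t u : pt N p t -> pt N p u -> pt N q t = pt N q u.
Proof.
by move=> a b; apply/idP/idP => c; [apply: (g_fc gN a c b) | apply: (g_fc gN b c a)].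
Qed.

Lemma Mf_dead t : ~ enabled N t (Mf N).
Proof. by move=> [/(g_pre gN)[p a] /(_ p a)]; rewrite (pt_Mf a). Qed.

Lemma live_or_final M : reach N M -> M <> Mf N -> exists t, enabled N t M.
Proof. by move=> /(g_sound gN)[[|t s] //= [en _] _ _]; exists t. Qed.

Lemma complete_ext s : firable N (M0 N) s -> exists s', complete N (s ++ s').
Proof.
move=> fs; have [|s' fs' E] := @g_sound _ _ _ gN (after N (M0 N) s); first by exists s.
by exists s'; split; [apply/firable_cat | rewrite after_cat].
Qed.

(** Take the first transition of the run that consumes from [q]; until then the token stays
    there. *)
Lemma consumed q s M : firable N M s -> 0 < M q -> after N M s q = 0 ->
  exists s1 v, [/\ firable N M s1, enabled N v (after N M s1) & pt N q v].
Proof.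
elim: s M => [|v s IH] M /=; first by move=> _ h e; rewrite e in h.
move=> [en fs] Mq aq; case qv: (pt N q v); first by exists [::], v.
have [|s1 [u [f1 e1 qu]]] := IH _ fs _ aq; first by rewrite /fire qv; lia.
by exists (v :: s1), u.
Qed.

(* Soundness consumes the token on [q], and free choice lets [u] do so. *)
Lemma consumable M q u : reach N M -> 0 < M q -> pt N q u ->
  exists2 M', reach N M' & enabled N u M'.
Proof.
move=> rM Mq qu; have [s fs E] := g_sound gN rM.
have [|s1 [v [f1 [_ en] qv]]] := consumed fs Mq; first by rewrite E (pt_Mf qu).
exists (after N M s1); first exact: reach_after.
by split; [apply: pt_trans qu | move=> p pu; apply: en; rewrite (fc_eq p qv qu)].
Qed.

(** Induction on the rank: a place other than the source has a producer, whose input places have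
    smaller rank; once one of them is marked, [consumable] lets the producer fire. *)
Lemma place_markable p : p \in places N -> exists2 M, reach N M & 0 < M p.
Proof.
have [n] := ubnP (rk p); elim: n p => // n IH p lp pP.
case: (eqVneq p (src N)) => [->|/eqP ne].
  by exists (M0 N); [apply: reach0 | rewrite /M0 eqxx].
have [u up] := g_in gN pP ne; have [q qu] := g_pre gN (tp_trans up).
have [|M rM Mq] := IH q _ (pt_place qu); first by have := g_rk gN qu up; lia.
have [M' rM' en] := consumable rM Mq qu.
exists (fire N u M'); first exact: reach_fire.
by rewrite /fire up addn1.
Qed.

Lemma trans_fires t : t \in trans N -> exists2 M, reach N M & enabled N t M.
Proof.
move=> tN; have [q qt] := g_pre gN tN.
have [M rM Mq] := place_markable (pt_place qt).
exact: consumable rM Mq qt.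
Qed.

Lemma trans_in_complete t : t \in trans N -> exists2 s, complete N s & t \in s.
Proof.
move=> /trans_fires[M [s fs ->] en].
have [|s' cs] := @complete_ext (s ++ [:: t]); first by apply/firable_cat.
by exists ((s ++ [:: t]) ++ s'); rewrite // !mem_cat inE eqxx orbT.
Qed.

(** A policy resolving each choice by list order. The default 0 is returned only for places without
    output transitions. *)
Definition pol p := head 0 [seq u <- trans N | pt N p u].
Definition follows t := all (fun p => pt N p t ==> (t == pol p)) (places N).

(** By free choice, transitions sharing an input place have the same input places, so the pick of
    the policy is enabled along with [u], and all its input places agree on it. *)
Lemma follows_exists M u : enabled N u M -> exists2 t, follows t & enabled N t M.
Proof.
move=> [uN en]; have [p pu] := g_pre gN uN.
have tp' : pol p \in [seq u <- trans N | pt N p u].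
  have : u \in [seq u <- trans N | pt N p u] by rewrite mem_filter pu.
  by rewrite /pol; case: [seq _ <- _ | _] => //= a l _; rewrite inE eqxx.
move: (tp'); rewrite mem_filter => /andP[pp pN].
exists (pol p).
  apply/allP => q _; apply/implyP => qt; apply/eqP; rewrite /pol; congr head.
  by apply: eq_filter => v; apply/idP/idP => [/(g_fc gN pp qt)|/(g_fc gN qt pp)].
by split=> // q qt; apply: en; rewrite (fc_eq q pu pp).
Qed.

(* Resolve every choice in favour of the first transition of the cluster: then two tokens on a
   place force two tokens through a successor place, and finally two tokens on the sink. *)
Lemma safe M p : reach N M -> p \in places N -> M p <= 1.
Proof.
move=> rM pP; have [B bB] := runs_bounded M.
have [s [fs /allP fol ms]] := firable_maximal follows bB.
have E : after N M s = Mf N.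
  case: (classic (after N M s = Mf N)) => // ne.
  have [t en] := live_or_final (reach_after rM fs) ne.
  by have [u fu eu] := follows_exists en; case: (ms u fu).
(* Counting also the tokens that [s] still produces on [p] makes the bound provable by induction
   from places of higher rank. *)
suff : M p + count (fun t => tp N t p) s <= 1 by lia.
have [n] := ubnP (H - rk p); elim: n p pP => // n IH p pP lp.
have := marking_equation p fs; rewrite E.
case: (eqVneq p (snk N)) => [->|ne].
  rewrite /Mf eqxx /= => <-.
  by rewrite (@eq_count _ _ pred0) ?count_pred0 // => t; apply/negbTE/(g_snk gN).
rewrite {1}/Mf (negbTE ne) add0n => <-.
rewrite leqNgt; apply/negP => two.
have le : count (pt N p) s <= count_mem (pol p) s.
  rewrite (@eq_in_count _ (pt N p) (predI (pred1 (pol p)) (pt N p))) => [|t ts] /=.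
    by apply: sub_count => t /= /andP[].
  have /allP/(_ p pP)/implyP := fol t ts.
  by case: (pt N p t) => [->|_] //=; rewrite andbF.
have ps : pol p \in s by rewrite -has_pred1 has_count; lia.
have pN := firable_trans fs ps.
have [q pq] := g_post gN pN.
have : has (pt N p) s by rewrite has_count; lia.
case/hasP => t ts pt'.
have /allP/(_ p pP)/implyP/(_ pt')/eqP Et := fol t ts.
have le2 : count_mem (pol p) s <= count (fun t => tp N t q) s.
  by apply: sub_count => x /= /eqP->.
have rkq : rk p < rk q by apply: (@g_rk _ _ _ gN _ t) => //; rewrite Et.
have qP := tp_place pq.
have := IH q qP; have : H - rk q < n; last by lia.
by have := g_H gN qP; lia.
Qed.


(** * Irreducible nets *)

Definition solo t := forall p u, pt N p t -> pt N p u -> u = t.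

Definition mergeable t1 t2 :=
  [/\ t1 \in trans N, t2 \in trans N, t1 != t2,
      forall p, pt N p t1 = pt N p t2 & forall p, tp N t1 p = tp N t2 p].

(** Local form of the d-shortcut condition: by [solo t'], the cluster of [t'] is [t'] with its input
    places ([in_clusterE]). *)
Definition chained t t' :=
  [/\ t \in trans N, t' \in trans N, solo t' & forall p, pt N p t' -> tp N t p].

Lemma solo_count t p s : solo t -> pt N p t -> count (pt N p) s = count_mem t s.
Proof.
move=> st a; apply: eq_count => u /=.
by apply/idP/eqP => [/(st p u a)|->].
Qed.

(** Firing [t] and then [t'] would put two tokens on [p], against safety. *)
Lemma chained_disjoint t t' p : chained t t' -> tp N t p -> tp N t' p -> False.
Proof.
move=> [tN t'N _ sub] tp1 tp2; have [M rM en] := trans_fires tN.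
have en' : enabled N t' (fire N t M).
  by split=> // q /sub; rewrite /fire => ->; rewrite addn1.
have r2 := reach_fire (reach_fire rM en) en'.
have := safe r2 (tp_place tp1); rewrite {1}/fire tp2.
have -> : pt N p t' = false by apply/negP => /pt_tp; rewrite tp2.
by rewrite /fire tp1; lia.
Qed.

Lemma no_choice_progress : (forall t, t \in trans N -> solo t) ->
  final_net N (src N) (snk N) \/ exists t t', chained t t'.
Proof.
move=> so.
have ne : M0 N <> Mf N.
  by move=> /(congr1 (@^~ (src N))); rewrite /M0 /Mf eqxx (negbTE (g_neq gN)).
have only t : enabled N t (M0 N) -> forall p, pt N p t <-> p = src N.
  move=> [tN en]; have sub p : pt N p t -> p = src N.
    by move/en; rewrite /M0; case: eqP.
  by have [q qt] := g_pre gN tN; move=> p; split=> [/sub|->] //; rewrite -(sub q).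
have [t0 e0] := live_or_final (@reach0 N) ne.
have pt0 := only _ e0; have [t0N _] := e0.
case: (classic (fire N t0 (M0 N) = Mf N)) => [E|ne1]; last first.
  have [u [uN eu]] := live_or_final (reach_fire (@reach0 N) e0) ne1.
  right; exists t0, u; split=> // [|p pu]; first exact: so.
  have := eu p pu; rewrite /fire /M0; case: (eqVneq p (src N)) => [->|_].
    have -> : pt N (src N) t0 by apply/pt0.
    by case: (tp N t0 _).
  by case: (tp N t0 p).
left.
(* Every transition occurs in a complete run, and each complete run is just [t0]. *)
have tr u : u \in trans N -> u = t0.
  move=> /trans_in_complete[[|x s] [fs _]] //.
  case: fs => ex fs; have ext : x = t0.
    by apply: (so _ t0N (src N)); [apply/pt0 | apply/(only x ex)].
  move: fs; rewrite ext E; case: s => [|y s] /=; last by case=> /Mf_dead.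
  by move=> _; rewrite inE => /eqP.
have t0E p : tp N t0 p <-> p = snk N.
  have := congr1 (@^~ p) E; rewrite /fire /M0 /Mf => Ep; split=> [tt|ep].
    by move: Ep; rewrite tt; case: (eqVneq p (snk N)) => //; lia.
  by move: Ep; rewrite ep eqxx eq_sym (negbTE (g_neq gN)); case: (tp N t0 _).
split; last by exists t0; split=> // u; split=> [/tr|->].
move=> p; split=> [pP|[->|->]]; [|exact: (g_srcP gN)|exact: (g_snkP gN)].
case: (eqVneq p (src N)) => [|/eqP np]; first by left.
by have [u up] := g_in gN pP np; right; apply/t0E; rewrite -(tr u) // (tp_trans up).
Qed.

(* Fire a choice after which no further choice is ever enabled. Both alternatives [ta] and [tb]
   continue to the final marking through forced transitions; unless the d-shortcut rule applies,
   each of these has an input place outside the outputs of [ta] and one outside those of [tb], so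
   by induction on the rank both continuations fire it equally often. The marking equation then
   identifies the outputs of [ta] and [tb]. *)
Lemma choice_progress ta0 tb0 p0 :
  ta0 <> tb0 -> pt N p0 ta0 -> pt N p0 tb0 ->
  (forall t t', ~ chained t t') -> exists t1 t2, mergeable t1 t2.
Proof.
move=> ne0 pa0 pb0 irr.
pose Q M := exists ta tb p, [/\ enabled N ta M, ta <> tb, pt N p ta & pt N p tb].
have [M1 r1 en1] := trans_fires (pt_trans pa0).
have [B bB] := runs_bounded M1.
have [|M [rM [ta [tb [p [ea ne pa pb]]]] lastM]] := @last_marking N Q B M1 bB r1.
  by exists ta0, tb0, p0.
have pab q : pt N q ta = pt N q tb := fc_eq q pa pb.
have eb : enabled N tb M.
  by case: ea => _ ea; split=> [|q]; [apply: pt_trans pb | rewrite -pab; apply: ea].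
(* A transition with a competitor would be an enabled choice strictly after [M], but no nonempty run
   from [M] leads to one. *)
have forced t s : enabled N t M -> firable N (fire N t M) s ->
    forall v, v \in s -> solo v /\ v \in trans N.
  move=> en fs v vs; split; last exact: firable_trans fs v vs.
  have [s1 [s2 [_ f1 ev]]] := firable_split fs vs.
  move=> q u qv qu; case: (eqVneq u v) => // /eqP uv.
  by case: (lastM t s1); [split | exists v, u, q; split=> // e; apply: uv].
have [sa fa Ea] := g_sound gN (reach_fire rM ea).
have [sb fb Eb] := g_sound gN (reach_fire rM eb).
have cnt : forall v, count_mem v sa = count_mem v sb.
  (* The transitions feeding the input places of [v] have inputs of smaller rank, so the induction
     hypothesis covers them. *)
  have C n v : (forall q, pt N q v -> rk q < n) -> count_mem v sa = count_mem v sb.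
    elim: n v => [|n IH] v lv.
      case: (boolP (v \in trans N)) => [/(g_pre gN)[q /lv]|vN] //.
      by rewrite !(count_memPn _) //; apply: contra vN;
        [apply: firable_trans fb v | apply: firable_trans fa v].
    case: (boolP ((v \in sa) || (v \in sb))) => [vs|]; last first.
      by rewrite negb_or => /andP[va vb]; rewrite !(count_memPn _).
    have [sv vN] : solo v /\ v \in trans N.
      by case/orP: vs => [/(forced _ _ ea fa)|/(forced _ _ eb fb)].
    have out t : t \in trans N -> exists2 q, pt N q v & tp N t q = false.
      move=> tN; apply: NNPP => no; apply: (irr t v); split=> // q qv.
      by case tq: (tp N t q) => //; case: no; exists q.
    (* Only [v] consumes from [q], and [q] ends empty, so [v] fires once per token on [q]. By
       induction [sa] and [sb] feed [q] equally often. *)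
    have E q : pt N q v ->
        count_mem v sa = M q + tp N ta q + count (fun t => tp N t q) sa /\
        count_mem v sb = M q + tp N tb q + count (fun t => tp N t q) sa.
      move=> qv; have := marking_equation q fa; have := marking_equation q fb.
      rewrite Ea Eb (pt_Mf qv) !(solo_count _ sv qv) /fire -pab.
      have -> : pt N q ta = false.
        apply/negP => qa; apply: ne; rewrite (sv q ta qv qa) (sv q tb) //.
        by rewrite -pab.
      rewrite (@count_sub_mem (fun t => tp N t q) sb sa) => [|u uq]; first by lia.
      by apply/esym/IH => r ru; have := g_rk gN ru uq; have := lv q qv; lia.
    (* At [q1] the choice [ta] adds no token, so [v] occurs in [sa] at most as often as in [sb];
       [q2] gives the converse. *)
    have [q1 qv1 t1] := out ta (pt_trans pa).
    have [q2 qv2 t2] := out tb (pt_trans pb).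
    by have := E q1 qv1; have := E q2 qv2; rewrite t1 t2; lia.
  move=> v; pose b := \max_(q <- places N) rk q; apply: (C b.+1) => q qv.
  by rewrite ltnS; apply: leq_bigmax_seq => //; apply: pt_place qv.
exists ta, tb; split; [exact: pt_trans pa|exact: pt_trans pb|exact/eqP|done|].
move=> q; have := marking_equation q fa; have := marking_equation q fb.
rewrite Ea Eb /fire -pab (@count_sub_mem (pt N q) sb sa) => [|u _]; last by rewrite cnt.
rewrite (@count_sub_mem (fun t => tp N t q) sb sa) => [|u _]; last by rewrite cnt.
by case: (tp N ta q); case: (tp N tb q) => //=; lia.
Qed.

Lemma progress :
  [\/ final_net N (src N) (snk N), exists t1 t2, mergeable t1 t2 |
      exists t t', chained t t'].
Proof.
case: (classic (exists t t', chained t t')) => [|irr]; first by constructor 3.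
case: (classic (exists a b p, [/\ a <> b, pt N p a & pt N p b])).
  move=> [a [b [p [ab pa pb]]]]; constructor 2.
  by apply: (choice_progress ab pa pb) => t t' tt; apply: irr; exists t, t'.
move=> no; case: no_choice_progress => [t _ p u pt' pu|fin|/irr] //; last by constructor 1.
by apply: NNPP => ut; apply: no; exists u, t, p.
Qed.

End Good.
End Runs.

(** * Simulation by a reduced net *)

Section Simulation.
Variables (L : Type) (rk : nat -> nat) (H : nat) (N N' : wnet L) (e : nat -> seq nat).
Hypotheses (gN : good rk H N) (srcE : src N' = src N) (snkE : snk N' = snk N).
Hypothesis esim : forall M u, enabled N' u M ->
  firable N M (e u) /\ after N M (e u) = fire N' u M.
Hypothesis epos : forall u, 0 < size (e u).
Hypothesis elive : forall M u, reach N' M -> enabled N u M -> exists u', enabled N' u' M.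

Definition expand s := flatten [seq e u | u <- s].

Lemma expand_firable M s : firable N' M s ->
  firable N M (expand s) /\ after N M (expand s) = after N' M s.
Proof.
elim: s M => [|u s IH] M //= [/esim[f1 a1] /IH[f2 a2]].
by rewrite /expand /= after_cat a1 a2 firable_cat a1.
Qed.

Lemma size_expand s : size s <= size (expand s).
Proof.
elim: s => //= u s; rewrite /expand /= size_cat.
by have := epos u; lia.
Qed.

Lemma M0E : M0 N' = M0 N. Proof. by rewrite /M0 srcE. Qed.
Lemma MfE : Mf N' = Mf N. Proof. by rewrite /Mf snkE. Qed.

Lemma expand_complete s : complete N' s -> complete N (expand s).
Proof.
rewrite /complete M0E MfE => -[fs as_].
by have [f a] := expand_firable fs; rewrite a.
Qed.

(** Expansion bounds the runs of [N'], so a maximal one exists. It ends in a marking reachable in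
    [N]; if this were not final, [N] would enable a transition there, and by [elive] so would
    [N']. *)
Lemma sim_sound M : reach N' M -> exists2 s, firable N' M s & after N' M s = Mf N'.
Proof.
move=> rM; have [B bB] := runs_bounded gN M.
have [|s [fs _ ms]] := @firable_maximal L N' predT B M.
  by move=> s /expand_firable[/bB]; have := size_expand s; lia.
exists s => //; apply: NNPP => ne; rewrite MfE in ne.
have rs := reach_after rM fs.
have rN : reach N (after N' M s).
  case: rs => s' /expand_firable[f a] ->; rewrite -a.
  by rewrite M0E in f *; exists (expand s').
have [u eu] := live_or_final gN rN ne.
by have [u' /ms] := elive rs eu; apply.
Qed.

End Simulation.

(** Markings are functions on all naturals, so their support has to be derived: tokens start on the
    source or arrive along arcs. This excludes tokens on removed cluster places. *)
Lemma reach_place (L : Type) (N : wnet L) M p :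
  well_formed N -> src N \in places N -> reach N M -> 0 < M p -> p \in places N.
Proof.
move=> [_ _ _ tpN] sP [s fs ->] Mp; have := marking_equation p fs.
case: (boolP (p \in places N)) => // pP.
rewrite (@eq_count _ (fun t => tp N t p) pred0) => [|t]; last first.
  by apply: contraNF pP => /tpN/andP[].
have -> : M0 N p = 0 by rewrite /M0; case: eqP pP => // ->; rewrite sP.
by rewrite count_pred0; lia.
Qed.

(** * The merge rule *)

Section Merge.
Variables (L : Type) (cup : L -> L -> L) (rk : nat -> nat) (H : nat) (N : wnet L).
Variables t1 t2 t : nat.
Hypotheses (gN : good rk H N) (m12 : mergeable N t1 t2) (fresh : t \notin trans N).

Let orig u := if u == t then t1 else u.
Let kept u := (u == t) || (u != t1) && (u != t2).

Definition merge_net : wnet L := WNet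
  (places N) (t :: [seq u <- trans N | (u != t1) && (u != t2)]) (src N) (snk N)
  (fun p u => kept u && pt N p (orig u)) (fun u p => kept u && tp N (orig u) p)
  (fun u => if u == t then cup (lam N t1) (lam N t2) else lam N u).

Lemma merge_trans u : (u \in trans merge_net) = kept u && (orig u \in trans N).
Proof.
case: m12 => t1N _ _ _ _; rewrite /= inE mem_filter /kept /orig.
by case: eqP => //= _; rewrite t1N.
Qed.

Lemma merge_orig u : u \in trans N -> exists2 v, v \in trans merge_net &
  (forall p, pt merge_net p v = pt N p u) /\ (forall p, tp merge_net v p = tp N u p).
Proof.
case: m12 => t1N t2N ne ptE tpE uN.
case: (boolP ((u == t1) || (u == t2))) => [u12|]; last first.
  rewrite negb_or => un; have ut : (u == t) = false by apply: contraNF fresh => /eqP<-.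
  by exists u; rewrite ?merge_trans /= /kept /orig ut un.
exists t; first by rewrite inE eqxx.
by rewrite /= /kept /orig eqxx /=; case/orP: u12 => /eqP->; split=> p //; rewrite ?ptE ?tpE.
Qed.

Lemma merge_net_step : merge_step cup N merge_net.
Proof.
case: m12 => t1N t2N ne ptE tpE.
have tt1 : t <> t1 by move=> e; move: fresh; rewrite e t1N.
have tt2 : t <> t2 by move=> e; move: fresh; rewrite e t2N.
exists t1, t2, t; split=> //; split=> //; split.
  by split=> //=; rewrite filter_uniq ?andbT ?mem_filter ?(negbTE fresh) ?andbF //; case: (g_wf gN).
split=> [u|p u|u p||u _ /eqP/negbTE] /=.
- rewrite inE mem_filter; split=> [/orP[/eqP->|/andP[/andP[/eqP ? /eqP ?] ?]]|]; first by left.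
    by right.
  by case=> [->|[-> [/eqP-> /eqP->]]]; rewrite ?eqxx ?orbT.
- rewrite /kept /orig; case: (eqVneq u t) => [->|/eqP ut] /=.
    by split=> [?|[[]|[_ [_ []]]]] //; left.
  split=> [/andP[/andP[/eqP ? /eqP ?] ?]|[[]|[/eqP-> [/eqP-> [_ ->]]]]] //; by right.
- rewrite /kept /orig; case: (eqVneq u t) => [->|/eqP ut] /=.
    by split=> [?|[[]|[_ [_ []]]]] //; left.
  split=> [/andP[/andP[/eqP ? /eqP ?] ?]|[[]|[/eqP-> [/eqP-> [_ ->]]]]] //; by right.
- by rewrite eqxx.
- by move=> ->.
Qed.

Lemma merge_sim M u : enabled merge_net u M ->
  firable N M [:: orig u] /\ after N M [:: orig u] = fire merge_net u M.
Proof.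
rewrite /enabled merge_trans => -[/andP[ku uN] en]; split=> /=.
  by split=> //; split=> // p pu; apply: en; rewrite /= ku.
by apply: functional_extensionality => p; rewrite /fire /= ku.
Qed.

Lemma merge_good : good rk H merge_net.
Proof.
case: m12 => t1N t2N ne ptE tpE; have [uP uT ptN tpN] := g_wf gN.
split=> /=.
- split=> //= [|p u /andP[ku /ptN/andP[pP uN]]|u p /andP[ku /tpN/andP[uN pP]]].
  + by rewrite filter_uniq ?andbT ?mem_filter ?(negbTE fresh) ?andbF.
  + by rewrite pP; move: (merge_trans u); rewrite /= ku uN => ->.
  + by rewrite pP; move: (merge_trans u); rewrite /= ku uN => ->.
- exact: g_srcP gN.
- exact: g_snkP gN.
- exact: g_neq gN.
- by move=> u; rewrite negb_and (g_src gN) orbT.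
- by move=> u; rewrite negb_and (g_snk gN) orbT.
- move=> p pP np; have [u up] := g_in gN pP np.
  by have [v _ [_ E]] := merge_orig (tp_trans gN up); exists v; move: (E p) => /= ->.
- move=> u; move: (merge_trans u) => /= -> /andP[ku uN].
  by have [p pu] := g_pre gN uN; exists p; rewrite ku.
- move=> u; move: (merge_trans u) => /= -> /andP[ku uN].
  by have [p pu] := g_post gN uN; exists p; rewrite ku.
- move=> p q u v /andP[_ a] /andP[_ b] /andP[kv c]; rewrite kv; exact: g_fc gN _ _ _ _ a b c.
- move=> p u q /andP[_ a] /andP[_ b]; exact: g_rk gN _ _ _ a b.
- exact: g_H gN.
- apply: (@sim_sound L rk H N merge_net (fun u => [:: orig u]) gN erefl erefl merge_sim).
    by [].
  move=> M u _ [uN en]; have [v vN [E _]] := merge_orig uN.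
  by exists v; split=> // p; rewrite E; apply: en.
Qed.

Lemma merge_expand s : expand (fun u => [:: orig u]) s = map orig s.
Proof. by elim: s => //= u s; rewrite /expand /= => ->. Qed.

Lemma merge_bound (f : nat -> nat) :
  (forall s u, complete N s -> u \in s -> size s <= (f u).+1) ->
  exists f' : nat -> nat,
  [/\ forall s u, complete merge_net s -> u \in s -> size s <= (f' u).+1,
      \sum_(u <- trans merge_net) f' u <= \sum_(u <- trans N) f u &
      size (trans merge_net) < size (trans N)].
Proof.
case: m12 => t1N t2N ne _ _ fN; have [_ uT _ _] := g_wf gN.
(* A run through [t] maps to an equally long run through [t1], and the maximum is at most the sum
   [f t1 + f t2] that it replaces. *)
exists (fun u => if u == t then maxn (f t1) (f t2) else f u); split.
- move=> s u cs us.
  have := expand_complete (N := N) (N' := merge_net) erefl erefl merge_sim cs.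
  rewrite merge_expand => cm; have := fN _ (orig u) cm (map_f _ us).
  by rewrite size_map /orig /=; case: eqP => // _; lia.
- rewrite /= big_cons eqxx big_filter.
  rewrite (bigD1_seq t1) //= -[X in _ <= _ + X]big_filter.
  rewrite (bigD1_seq t2) /= ?filter_uniq ?mem_filter ?t2N ?(eq_sym t2) ?ne // big_filter_cond.
  rewrite addnA; apply: leq_add; first by lia.
  rewrite big_seq_cond [leqRHS]big_seq_cond; apply: eq_leq; apply: eq_big => // u.
  by move=> /andP[uN _]; case: eqP => // ut; move: fresh; rewrite -ut uN.
- rewrite /= size_filter -(count_predC (predC (pred2 t1 t2)) (trans N)).
  have -> : count (fun u => (u != t1) && (u != t2)) (trans N) =
            count (predC (pred2 t1 t2)) (trans N).
    by apply: eq_count => u /=; rewrite negb_or.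
  rewrite -addn1 -addn1 -addnA leq_add2l.
  have -> : count (predC (predC (pred2 t1 t2))) (trans N) =
            count_mem t1 (trans N) + count_mem t2 (trans N).
    rewrite -count_predUI (@eq_count _ (predI _ _) pred0) ?count_pred0 ?addn0.
      by apply: eq_count => u /=; rewrite negbK.
    by move=> u /=; case: eqP => //= ->; apply/negbTE.
  by rewrite !count_uniq_mem // t1N t2N.
Qed.

End Merge.

(** * The d-shortcut rule *)

Section Shortcut.
Variables (L : Type) (comp : L -> L -> L) (rk : nat -> nat) (H : nat) (N : wnet L).
Variables t t' ts : nat.
Hypotheses (gN : good rk H N) (ch : chained N t t') (fresh : ts \notin trans N).

(** Boolean form of the removal condition, in terms of the old net: no transition other than [t]
    feeds the cluster. *)
Let drop_cluster :=
  all (fun p => pt N p t' ==> all (fun u => (u != t) ==> ~~ tp N u p) (trans N)) (places N).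
Let orig u := if u == ts then t else u.
Let kept u := (u == ts) || (u != t) && ~~ (drop_cluster && (u == t')).
Let outs u p :=
  if u == ts then tp N t p && ~~ pt N p t' || tp N t' p else tp N u p.

Definition shortcut_net : wnet L := WNet
  [seq p <- places N | ~~ (drop_cluster && pt N p t')]
  (ts :: [seq u <- trans N | (u != t) && ~~ (drop_cluster && (u == t'))])
  (src N) (snk N)
  (fun p u => kept u && pt N p (orig u)) (fun u p => kept u && outs u p)
  (fun u => if u == ts then comp (lam N t) (lam N t') else lam N u).

Lemma chained_neq : t != t'.
Proof.
case: ch => tN t'N _ sub; apply/eqP => e; have [p pt'] := g_pre gN t'N.
by have := sub p pt'; rewrite e (pt_tp gN pt').
Qed.

Lemma chained_pt p : pt N p t' -> pt N p t = false.
Proof.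
case: ch => _ _ so _ pt'; apply/negP => /(so p t pt') e.
by move: chained_neq; rewrite e eqxx.
Qed.

Lemma drop_clusterP p u : drop_cluster -> pt N p t' -> tp N u p -> u = t.
Proof.
move=> /allP dr pt' up; have /implyP/(_ pt')/allP := dr p (pt_place gN pt').
by move=> /(_ u (tp_trans gN up)); rewrite up; case: eqP.
Qed.

Lemma trans_fresh u : u \in trans N -> (u == ts) = false.
Proof. by move=> uN; apply: contraNF fresh => /eqP<-. Qed.

Lemma shortcut_trans u : (u \in trans shortcut_net) = kept u && (orig u \in trans N).
Proof.
case: ch => tN _ _ _; rewrite /= inE mem_filter /kept /orig.
by case: eqP => //= _; rewrite tN.
Qed.

(** Only [t'] consumes from its input places, so the closure stops there. *)
Lemma in_clusterE z :
  in_cluster N (TN t') z <-> z = TN t' \/ exists2 p, z = PN p & pt N p t'.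
Proof.
case: ch => _ _ so _; split=> [|[->|[p -> pt']]]; [|exact: rt_refl|exact: rt_step].
move/clos_rt_rtn1_iff; elim=> [|y {}z st _ [ey|[p ey pt']]]; first by left.
  by move: st; rewrite ey; case: z => //= p; right; exists p.
by move: st; rewrite ey; case: z => //= u /(so _ _ pt') ->; left.
Qed.

Lemma cluster_place p : in_cluster N (TN t') (PN p) <-> pt N p t'.
Proof. by rewrite in_clusterE; split=> [[//|[q [->]]]|pt'] //; right; exists p. Qed.

Lemma cluster_trans u : in_cluster N (TN t') (TN u) <-> u = t'.
Proof. by rewrite in_clusterE; split=> [[[//]|[]]|->] //; left. Qed.

Lemma shortcut_net_step : shortcut_step comp N shortcut_net.
Proof.
have [uP uT ptN tpN] := g_wf gN; case: ch => tN t'N so sub.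
have tts : t <> ts by move=> e; move: fresh; rewrite -e tN.
have tts' : t' <> ts by move=> e; move: fresh; rewrite -e t'N.
exists t, (TN t'), t', ts; split; [split=> //|split; [split=> //|]].
- move=> /(_ (TN t'))[/(_ (rt_refl _ _ _)) cs _].
  have : forall z, in_cluster N (PN (snk N)) z -> z = PN (snk N).
    move=> z /clos_rt_rtn1_iff; elim=> // y {}z st _ ey; move: st; rewrite ey.
    by case: z => //= u; rewrite (negbTE (g_snk gN u)).
  by move=> /(_ _ cs).
- move=> /(_ (TN t))[_ /(_ (rt_refl _ _ _))]/cluster_trans e.
  by move: chained_neq; rewrite e eqxx.
- by move=> p u /cluster_place pt' /cluster_trans->.
- exact: cluster_trans.
- by move=> p /cluster_place/sub.
move=> ptI tpI rem inc.
(* [ts] never feeds the cluster: its places are cut from the outputs of [t], and acyclicity keeps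
   them out of the outputs of [t']. *)
have remE : rem <-> drop_cluster.
  split=> [r|dr p u /cluster_place pt'].
    apply/allP => p pP; apply/implyP => pt'; apply/allP => u uN; apply/implyP => ut.
    apply/negP => up; apply: (r p u); first exact/cluster_place.
    by left; split; [apply/eqP | split=> // e; move: fresh; rewrite -e uN].
  case=> [[ut [_ up]]|[_ [[_]|]]]; first by apply/ut/(drop_clusterP dr pt' up).
    by rewrite pt'.
  by rewrite (pt_tp gN pt').
have incE p : inc p <-> drop_cluster && pt N p t'.
  by rewrite /inc remE cluster_place; split=> /andP.
have keepE u : ~ (rem /\ u = t') <-> ~~ (drop_cluster && (u == t')).
  by rewrite remE; split=> [h|/negP h [dr e]]; [apply/negP => /andP[dr /eqP e]; apply: h |
    apply: h; rewrite dr e eqxx].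
have incN p : ~ inc p <-> ~~ (drop_cluster && pt N p t').
  by rewrite incE; split=> /negP.
split; first by split=> //=; rewrite ?filter_uniq ?andbT ?mem_filter ?(negbTE fresh) ?andbF.
split; last by split=> /= [|u _ /eqP/negbTE->//]; rewrite eqxx.
split=> [p|u|p u|u p].
- by rewrite incN mem_filter andbC; split=> /andP.
- rewrite keepE /= inE mem_filter.
  case: (eqVneq u ts) => [->|/eqP ut] /=.
    split=> // _; split; first by left.
    by rewrite negb_and; apply/orP; right; apply/eqP => e; apply: tts'.
  split=> [/andP[/andP[/eqP ? ?] ?]|[[//|[? /eqP->]] ->//]].
  by split=> //; right.
- rewrite keepE incN /ptI /= /kept /orig; case: (eqVneq u ts) => [->|/eqP ut] /=.
    split=> [ptt|[[[_ [/(_ erefl)[]]]|[_ ->]]]] //; split; first by right.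
    rewrite !negb_and; split; apply/orP; right; last by apply/eqP => e; apply: tts'.
    by apply/negP => /chained_pt; rewrite ptt.
  split=> [/andP[/andP[/eqP ? k] pu]|[[[/eqP-> [_ ->]]|[/ut[]]] [_ ->]]] //.
  split; first by left.
  split=> //; move: k; apply: contra => /andP[-> pt'] /=.
  by apply/eqP; apply: so pt' pu.
- rewrite keepE incN /tpI /= /kept /outs; case: (eqVneq u ts) => [->|/eqP ut] /=.
    have K : ~~ (drop_cluster && (ts == t')).
      by rewrite negb_and; apply/orP; right; apply/eqP => e; apply: tts'.
    rewrite K; split=> [o|[[[_ [/(_ erefl)[]]]|[_ [/andP->|->]]] _]] //; last by rewrite orbT.
    split; first by right; split=> //; case/orP: o => [/andP|]; [left|right].
    split=> //; rewrite negb_and; apply/orP; right.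
    by case/orP: o => [/andP[]|tp'] //; apply/negP => /(pt_tp gN); rewrite tp'.
  split=> [/andP[/andP[/eqP ? k] pu]|[[[/eqP-> [_ ->]]|[/ut[]]] [_ ->]]] //.
  split; first by left.
  by split=> //; apply/negP => /andP[dr pt']; have := drop_clusterP dr pt' pu.
Qed.

Let e u := if u == ts then [:: t; t'] else [:: u].

Lemma shortcut_sim M u : enabled shortcut_net u M ->
  firable N M (e u) /\ after N M (e u) = fire shortcut_net u M.
Proof.
case: ch => tN t'N so sub.
rewrite /enabled shortcut_trans => -[/andP[ku uN] en].
have en' : enabled N (orig u) M.
  by split=> // p pu; apply: en; rewrite /= ku.
move: en' ku; rewrite /e /orig /fire /= /orig /outs; case: (eqVneq u ts) => [->|ut] en' ku /=.
  split; first split=> //.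
    by split=> //; split=> // p /sub; rewrite /fire => ->; rewrite addn1.
  apply: functional_extensionality => p; rewrite ku /fire /=.
  (* A cluster place gets a token from [t] and loses it to [t']; elsewhere, disjointness of the
     outputs makes the union of arcs agree with the sum of tokens. *)
  have := chained_disjoint (p := p) gN ch; have := sub p.
  case pt': (pt N p t') => /=.
    by rewrite (chained_pt pt') (pt_tp gN pt') => /(_ isT)->; lia.
  by case: (tp N t p); case: (tp N t' p) => //= _ D; [case: D | lia..].
by split=> //; apply: functional_extensionality => p; rewrite ku.
Qed.

Lemma e_pos u : 0 < size (e u). Proof. by rewrite /e; case: eqP. Qed.

(* If only [t] fed the place [p] of the cluster, [t'] would occur as often as [t] in a complete
   run; so no other place of the cluster could be fed by a transition [u] other than [t]. *)
Lemma cluster_fed p : ~~ drop_cluster -> pt N p t' -> exists2 u, u != t & tp N u p.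
Proof.
case: ch => tN t'N so sub ndr pt'.
have [q [u [qt' ut uq]]] : exists q u, [/\ pt N q t', u != t & tp N u q].
  move: ndr => /allPn[q _]; rewrite negb_imply => /andP[qt' /allPn[u _]].
  by rewrite negb_imply negbK => /andP[ut uq]; exists q, u.
apply: NNPP => no.
have [s [fs Es] us] := trans_in_complete gN (tp_trans gN uq).
have := marking_equation p fs; have := marking_equation q fs.
rewrite Es !(pt_Mf gN qt') !(pt_Mf gN pt') !(solo_count _ so) //.
have M00 x : pt N x t' -> M0 N x = 0.
  by move=> /sub; rewrite /M0; case: eqP => // ->; rewrite (negbTE (g_src gN t)).
rewrite !M00 //.
have -> : count (fun v => tp N v p) s = count_mem t s.
  apply: eq_count => v /=; apply/idP/eqP => [vp|->]; last exact: sub.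
  by apply/eqP/negPn/negP => vt; apply: no; exists v.
have : count_mem t s + count_mem u s <= count (fun v => tp N v q) s.
  rewrite -count_predUI (@eq_count _ (predI _ _) pred0) ?count_pred0 ?addn0.
    by apply: sub_count => v /= /orP[/eqP->|/eqP->] //; apply: sub.
  by move=> v /=; case: eqP => //= ->; rewrite eq_sym (negbTE ut).
have : 0 < count_mem u s by rewrite -has_count has_pred1.
lia.
Qed.

Lemma shortcut_good : good rk H shortcut_net.
Proof.
have [uP uT ptN tpN] := g_wf gN; case: ch => tN t'N so sub.
have src_out : ~~ pt N (src N) t' by apply/negP => /sub; rewrite (negbTE (g_src gN t)).
have tt' := chained_neq.
have wf : well_formed shortcut_net.
  split=> /=.
  + exact: filter_uniq.
  + by rewrite filter_uniq ?andbT ?mem_filter ?(negbTE fresh) ?andbF.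
  + move=> p u /andP[ku pu]; have /andP[pP uN] := ptN _ _ pu.
    move: (shortcut_trans u); rewrite /= ku uN => -> /=; rewrite andbT mem_filter pP andbT.
    apply/negP => /andP[dr pt']; have := so _ _ pt' pu; move: ku; rewrite /kept /orig dr.
    by case: eqP => [_ _ e'|_ /= /andP[_ /eqP]//]; move: tt'; rewrite e' eqxx.
  + move=> u p /andP[ku]; move: (shortcut_trans u); rewrite /= ku /outs /orig /kept => ->.
    rewrite mem_filter; move: ku; rewrite /kept; case: (eqVneq u ts) => [_ _|_ /= ku up].
      rewrite tN /= => /orP[/andP[tp1 npt]|tp1].
        by rewrite (tp_place gN tp1) (negbTE npt) andbF.
      rewrite (tp_place gN tp1) andbT; apply/negP => /andP[_ /(pt_tp gN)].
      by rewrite tp1.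
    rewrite (tp_trans gN up) (tp_place gN up) andbT /=; apply/negP => /andP[dr pt'].
    by move: ku; rewrite (drop_clusterP dr pt' up) eqxx.
have srcP : src N \in places shortcut_net.
  by rewrite mem_filter (negbTE src_out) andbF (g_srcP gN).
split=> //=.
- by rewrite mem_filter (negbTE (g_snk gN t')) andbF (g_snkP gN).
- exact: g_neq gN.
- move=> u; rewrite negb_and /outs; case: eqP => _; last by rewrite (g_src gN) orbT.
  by rewrite negb_or negb_and !(g_src gN) orbT.
- by move=> u; rewrite negb_and (g_snk gN) orbT.
- move=> p; rewrite mem_filter => /andP[npt pP] np.
  case pt': (pt N p t').
    have ndr : ~~ drop_cluster by move: npt; rewrite pt' andbT.
    have [u ut up] := cluster_fed ndr pt'; exists u.
    by rewrite /kept /outs (trans_fresh (tp_trans gN up)) ut (negbTE ndr).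
  have [u up] := g_in gN pP np; have nts := trans_fresh (tp_trans gN up).
  case: (eqVneq u t) => [ut|ut].
    by exists ts; rewrite /kept /outs eqxx -ut up pt'.
  case: (eqVneq u t') => [ut'|ut'].
    by exists ts; rewrite /kept /outs eqxx -ut' up orbT.
  by exists u; rewrite /kept /outs nts ut (negbTE ut') andbF.
- move=> u; move: (shortcut_trans u) => /= -> /andP[ku uN].
  by have [p pu] := g_pre gN uN; exists p; rewrite ku.
- move=> u; move: (shortcut_trans u) => /= -> /andP[ku uN].
  move: uN; rewrite ku /outs /orig; case: eqP => _ uN; last exact: g_post gN _ uN.
  by have [p tp'] := g_post gN t'N; exists p; rewrite tp' orbT.
- move=> p q u v /andP[_ a] /andP[_ b] /andP[kv c]; rewrite kv; exact: g_fc gN _ _ _ _ a b c.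
- move=> p u q /andP[_ a] /andP[_]; move: a; rewrite /orig /outs; case: eqP => _ a.
    case/orP=> [/andP[b _]|b]; first exact: g_rk gN _ _ _ a b.
    have [r rt'] := g_pre gN t'N.
    exact: ltn_trans (g_rk gN a (sub r rt')) (g_rk gN rt' b).
  exact: g_rk gN _ _ _ a.
- by move=> p; rewrite mem_filter => /andP[_ /(g_H gN)].
- apply: (@sim_sound L rk H N shortcut_net e gN erefl erefl shortcut_sim e_pos).
  move=> M u rM [uN en].
  case: (boolP (kept u)) => ku.
    exists u; split=> [|p]; first by rewrite shortcut_trans ku /orig trans_fresh.
    by rewrite /= ku /orig trans_fresh //; apply: en.
  (* Two transitions may be missing: [t], which [ts] replaces with the same inputs, and [t'] when
     the cluster is removed, whose enabling would need a token on a removed place. *)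
  move: ku; rewrite /kept (trans_fresh uN) /= negb_and !negbK.
  case: (eqVneq u t) => [ut _|_ /= /andP[dr /eqP ut']].
    exists ts; split=> [|p]; first by rewrite inE eqxx.
    by rewrite /= /kept /orig eqxx /= -ut; apply: en.
  have [p pt'] := g_pre gN t'N.
  have Mp : 0 < M p by apply: en; rewrite ut'.
  by have := reach_place wf srcP rM Mp; rewrite mem_filter dr pt'.
Qed.

Lemma size_shortcut_expand s : size (expand e s) = size s + count_mem ts s.
Proof.
elim: s => //= u s IH; rewrite /expand /= size_cat; move: IH; rewrite /expand => ->.
by rewrite /e; case: eqP => _ /=; lia.
Qed.

Lemma mem_shortcut_expand s u : u \in s -> orig u \in expand e s.
Proof.
move=> us; apply/flattenP; exists (e u); first exact: map_f.
by rewrite /e /orig; case: eqP => _; rewrite inE eqxx.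
Qed.

Lemma shortcut_bound (f : nat -> nat) :
  (forall s u, complete N s -> u \in s -> size s <= (f u).+1) ->
  exists f' : nat -> nat,
  [/\ forall s u, complete shortcut_net s -> u \in s -> size s <= (f' u).+1,
      \sum_(u <- trans shortcut_net) f' u < \sum_(u <- trans N) f u &
      size (trans shortcut_net) <= size (trans N)].
Proof.
case: ch => tN t'N _ _ fN; have [_ uT _ _] := g_wf gN.
(* Expansion adds one firing for each occurrence of [ts]; this is the gain for the sum. *)
have bd s u : complete shortcut_net s -> u \in s -> size s + count_mem ts s <= (f (orig u)).+1.
  move=> cs us; rewrite -size_shortcut_expand; apply: fN; last exact: mem_shortcut_expand.
  exact: (expand_complete (N := N) (N' := shortcut_net) erefl erefl shortcut_sim cs).
have bt s : complete shortcut_net s -> ts \in s -> size s <= f t.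
  move=> cs us; have := bd s ts cs us.
  have : 0 < count_mem ts s by rewrite -has_count has_pred1.
  by move: (count_mem ts s) => k; rewrite /orig eqxx /=; lia.
(* The new net is good, so [ts] occurs in some complete run. Positivity makes the predecessor of
   [f t] a strict decrease. *)
have ft : 0 < f t.
  have [|s cs us] := trans_in_complete shortcut_good (t := ts); first by rewrite inE eqxx.
  by apply: leq_trans (bt s cs us); case: s us {cs}.
exists (fun u => if u == ts then (f t).-1 else f u); split.
- move=> s u cs us; case: (eqVneq u ts) => [e'|ne].
    by rewrite prednK //; apply: bt => //; rewrite -e'.
  by have := bd s u cs us; rewrite /orig (negbTE ne); lia.
- rewrite /= big_cons eqxx [X in _ < X](bigD1_seq t) //= -addSn prednK // leq_add2l big_filter.
  rewrite big_seq_cond [leqRHS]big_seq_cond big_mkcond [leqRHS]big_mkcond /=.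
  apply: leq_sum => u _; case uN: (u \in trans N) => //=; rewrite trans_fresh //.
  by case: (u != t) => //=; case: ifP.
- rewrite /= size_filter -(count_predC (pred1 t) (trans N)) count_uniq_mem // tN /= add1n ltnS.
  by apply: sub_count => u /= /andP[].
Qed.

End Shortcut.

(** * Reduction to a single transition *)

(** Stated for any upper bound [f] on run lengths, so that the induction propagates bounds instead
    of exact shoc values. *)
Lemma reduction (L : Type) (cup comp : L -> L -> L) rk H (N : wnet L) (f : nat -> nat) :
  good rk H N ->
  (forall s u, complete N s -> u \in s -> size s <= (f u).+1) ->
  exists N' m d,
  [/\ reduces cup comp N N' m d, m <= size (trans N), d <= \sum_(t <- trans N) f t &
      final_net N' (src N) (snk N)].
Proof.
have [n] := ubnP (\sum_(t <- trans N) f t + size (trans N)).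
elim: n N f => // n IH N f lt gN fN.
pose fr := (\max_(u <- trans N) u).+1.
have fresh : fr \notin trans N.
  by apply/negP => /(@leq_bigmax_seq _ _ predT id) /(_ isT); rewrite /fr ltnn.
case: (progress gN) => [fin|[t1 [t2 m12]]|[t [t' ch]]].
- by exists N, 0, 0; split=> //; apply: red_refl.
- have [f' [bd sumf sz]] := merge_bound cup gN m12 fresh fN.
  have [|N' [m [d [red lm ld fin]]]] := IH _ f' _ (merge_good cup gN m12 fresh) bd; first by lia.
  exists N', m.+1, d; split; [|lia|lia|exact: fin].
  exact: red_merge (merge_net_step cup gN m12 fresh) red.
- have [f' [bd sumf sz]] := shortcut_bound comp gN ch fresh fN.
  have [|N' [m [d [red lm ld fin]]]] := IH _ f' _ (shortcut_good comp gN ch fresh) bd; first by lia.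
  exists N', m, d.+1; split; [|lia|lia|exact: fin].
  exact: red_short (shortcut_net_step comp gN ch fresh) red.
Qed.

(** * The given workflow net and its shoc values *)

Section Initial.
Variables (L : Type) (N : wnet L).

Definition decide (P : Prop) : bool := if excluded_middle_informative P then true else false.

Lemma decideP P : reflect P (decide P).
Proof. by rewrite /decide; case: excluded_middle_informative => h; constructor. Qed.

Definition before q p := clos_trans node (edge N) (PN q) (PN p).
Definition rank p := count (fun q => decide (before q p)) (places N).

(** All places before [p] are before [q], and so is [p] itself, which by acyclicity is not before
    [p]. *)
Lemma rank_lt p t q : well_formed N -> acyclic N -> pt N p t -> tp N t q -> rank p < rank q.
Proof.
move=> [_ _ ptN _] ac pt tq; have /andP[pP _] := ptN _ _ pt.
have pq : before p q.
  by apply: (@t_trans _ _ _ (TN t)); apply: t_step.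
pose a r := decide (before r p).
have -> : rank q = count a (places N) + count (fun r => decide (before r q) && ~~ a r) (places N).
  rewrite /rank -(count_predUI a) (@eq_count _ (predI _ _) pred0) ?count_pred0 ?addn0.
    apply: eq_count => r /=; case ar: (a r) => /=; last by rewrite andbT.
    by apply/decideP; apply: t_trans pq; apply/decideP.
  by move=> r /=; case: (a r); rewrite ?andbF.
rewrite -[X in X < _]addn0 ltn_add2l -has_count; apply/hasP; exists p => //.
by rewrite /a; apply/andP; split; [apply/decideP | apply/negP => /decideP/ac].
Qed.

Lemma initial_good :
  well_formed N -> workflow N -> sound N -> acyclic N -> free_choice N ->
  good rank (size (places N)) N.
Proof.
move=> wf [[sP kP ne] [si ko conn]] [snd _] ac fc.
have [uP uT ptN tpN] := wf.
(* The last edge of a path from the source enters [x]. The added edge from the sink enters only the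
   source, so any other node has a genuine predecessor. *)
have into x : in_net N x -> x = PN (src N) \/ exists y, edge_oi N y x.
  move=> xN; have /clos_rt_rtn1_iff := conn (PN (src N)) x sP xN.
  by case=> [|y z yz _]; [left | right; exists y].
have outof x : in_net N x -> x = PN (snk N) \/ exists y, edge_oi N x y.
  move=> xN; have /clos_rt_rt1n_iff := conn x (PN (snk N)) xN kP.
  by case=> [|y z xy _]; [left | right; exists y].
split=> //.
- move=> p pP np; have [[]//|[[q|t] [e|[_ []]]]//] := into (PN p) pP.
  by exists t.
- move=> t tN; have [//|[[p|u] [e|[_ //]]]//] := into (TN t) tN.
  by exists p.
- move=> t tN; have [//|[[p|u] [e|[//]]]//] := outof (TN t) tN.
  by exists p.
- move=> p q t u a b c; have /andP[pP _] := ptN _ _ a; have /andP[qP _] := ptN _ _ b.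
  by have [/(_ t)|<-//] := fc p q pP qP; rewrite a b.
- by move=> p t q; apply: rank_lt.
- by move=> p _; apply: count_size.
- move=> M [s fs ->]; have [s' [f' E]] := snd s fs.
  by exists s' => //; apply: functional_extensionality.
Qed.

Variables (rk : nat -> nat) (H : nat).
Hypothesis gN : good rk H N.

(** The final marking is the only dead reachable one. This turns the sequences defining shoc into
    the complete runs used by the reduction. *)
Lemma maximal_complete s : maximal_run N s <-> complete N s.
Proof.
split=> [[fs dead]|[fs E]]; split=> //; last by rewrite E => t /(Mf_dead gN).
apply: NNPP => ne; have [|u /dead//] := @live_or_final _ _ _ _ gN _ _ ne.
by exists s.
Qed.

(** The existential stands outside the implication so that choice yields a total function. The
    maximum exists because runs are bounded. *)
Lemma shoc_exists t : exists k, t \in trans N -> is_shoc N t k.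
Proof.
case: (boolP (t \in trans N)) => [tN|]; last by exists 0.
pose P k := decide (exists s, [/\ maximal_run N s, t \in s & size s = k.+1]).
have [s0 /maximal_complete c0 t0] := trans_in_complete gN tN.
have [B bB] := runs_bounded gN (M0 N).
have exP : exists k, P k.
  by case: s0 c0 t0 => // x s c0 t0; exists (size s); apply/decideP; exists (x :: s).
have leB k : P k -> k <= B by move=> /decideP[s [[/bB + _] _ e]]; rewrite e => /ltnW.
case: (ex_maxnP exP leB) => k /decideP Pk mk; exists k => _; split=> // s ms ts.
case: s ms ts => // x s ms ts; rewrite ltnS; apply: mk.
by apply/decideP; exists (x :: s).
Qed.

End Initial.

Theorem theoremA4 (L : Type) (cup comp : L -> L -> L) (W : wnet L) :
  well_formed W -> workflow W -> sound W -> acyclic W -> free_choice W ->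
  exists shocf : nat -> nat,
    (forall t, t \in trans W -> is_shoc W t (shocf t)) /\
    exists (W' : wnet L) (m d : nat),
      [/\ reduces cup comp W W' m d,
          m <= size (trans W),
          d <= \sum_(t <- trans W) shocf t &
          final_net W' (src W) (snk W)].
Proof.
move=> wf wk sd ac fc; have gW := initial_good wf wk sd ac fc.
pose shocf t := proj1_sig (constructive_indefinite_description _ (shoc_exists gW t)).
have shP t : t \in trans W -> is_shoc W t (shocf t).
  by rewrite /shocf; case: constructive_indefinite_description.
exists shocf; split=> //; apply: (reduction cup comp gW) => s u cs us.
have [_] := shP u (firable_trans (proj1 cs) us).
by apply=> //; apply/(maximal_complete gW).
Qed.
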